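(* Let $k\geq 3$ and let $\Delta_k'$ be the marked group $\mathbb{Z}/2\mathbb{Z}*\mathbb{Z}/2\mathbb{Z}=\langle a,b\mid a^2=b^2=1\rangle$ with generating set $\{ab,ba,aba,bab,\ldots,(ab)^{k-2}a,(ba)^{k-2}b\}$, i.e. the set of all elements whose reduced word in $a,b$ has length $\ell$ with $2\leq\ell\leq 2k-3$. Then $\chi_B(F(2^{\Delta_k'}))=k+1$.
   Context: A marked group is a finitely generated group $\Gamma$ with a finite symmetric generating set $S$ not containing the identity. The left shift action of $\Gamma$ on $2^\Gamma$ is $(g\cdot x)(h)=x(g^{-1}h)$; its free part is $F(2^\Gamma)=\{x\in 2^\Gamma : g\cdot x\neq x \text{ for all } g\neq \mathrm{id}\}$. The shift graph $F(2^\Gamma)$ is the graph on this free part joining distinct $x,y$ iff $s\cdot x=y$ for some $s\in S$. $\chi_B(G)$ denotes the Borel chromatic number: the least $k$ such that there is a Borel map $c$ from the vertex set to a $k$-element set with $c(x)\neq c(y)$ for adjacent $x,y$. *)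

(* Defs.v *)
From HB Require Import structures.
From mathcomp Require Import all_boot all_order all_algebra.
From mathcomp Require Import all_classical all_reals all_analysis.
Set Implicit Arguments.
Unset Strict Implicit.
Unset Printing Implicit Defensive.

Local Open Scope classical_set_scope.

Record markedGroup := MarkedGroup {
  mg_group :> groupType;
  mg_gens : set mg_group;
  mg_finite : finite_set mg_gens;
  mg_symmetric : forall s, mg_gens s -> mg_gens s^-1%g;
  mg_not1 : ~ mg_gens 1%g;
  mg_generates : forall H : set mg_group,
    H 1%g -> (forall x y, H x -> H y -> H (x * y)%g) ->
    (forall x, H x -> H x^-1%g) ->
    mg_gens `<=` H -> H = setT }.

Definition shift_space (G : groupType) : topologicalType := {ptws G -> bool}.

Definition shift_act (G : groupType) (g : G) (x : shift_space G) : shift_space G :=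
  fun h => x (g^-1 * h)%g.

Definition free_part (G : groupType) : set (shift_space G) :=
  [set x | forall g : G, g <> 1%g -> shift_act g x <> x].
Arguments free_part : clear implicits.

(* As a type, [free_part G] carries the subspace topology. *)
Definition shift_graph (G : markedGroup) (x y : free_part G) : Prop :=
  x <> y /\ exists2 s : G, mg_gens s & shift_act s (val x) = val y.

Definition borel_set (T : topologicalType) (A : set T) : Prop := <<s @open T >> A.

Definition borel_colorable (V : topologicalType) (adj : V -> V -> Prop)
    (n : nat) : Prop :=
  exists2 c : V -> 'I_n,
    (forall A : set 'I_n, borel_set (c @^-1` A)) &
    (forall x y, adj x y -> c x <> c y).

Definition borel_chromatic_number_is (V : topologicalType)
    (adj : V -> V -> Prop) (n : nat) : Prop :=
  borel_colorable adj n /\ forall m, borel_colorable adj m -> (n <= m)%N.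

(* The free product Z/2 * Z/2 as the group of reduced words in the letters
   a = false and b = true, i.e. words without two equal consecutive letters. *)
Definition reduced (w : seq bool) := sorted [rel x y | x != y] w.

Definition push (x : bool) (w : seq bool) : seq bool :=
  if w is y :: w' then if x == y then w' else x :: w else [:: x].

Definition mulw (u v : seq bool) : seq bool := foldr push v u.

Lemma reduced_cons x w : reduced (x :: w) -> reduced w.
Proof. by case: w => //= y w /andP[]. Qed.

Lemma reduced_push x w : reduced w -> reduced (push x w).
Proof.
case: w => //= y w; have [_|xy] := eqVneq x y; first exact: reduced_cons.
by rewrite /reduced/= xy.
Qed.

Lemma push_reduced x w : reduced (x :: w) -> push x w = x :: w.
Proof. by case: w => //= y w /andP[/negbTE ->]. Qed.

Lemma pushK x w : reduced w -> push x (push x w) = w.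
Proof.
case: w => [_|y w rw] /=; first by rewrite eqxx.
by have [->|xy] := eqVneq x y; [exact: push_reduced|rewrite /= eqxx].
Qed.

Lemma reduced_mulw u v : reduced v -> reduced (mulw u v).
Proof. by move=> rv; elim: u => //= x u IHu; exact: reduced_push. Qed.

Lemma mulw_push x u v : reduced v -> mulw (push x u) v = push x (mulw u v).
Proof.
case: u => // y u rv /=; have [->|//] := eqVneq x y.
by rewrite pushK//; exact: reduced_mulw.
Qed.

Lemma mulwA u v w : reduced w -> mulw u (mulw v w) = mulw (mulw u v) w.
Proof. by move=> rw; elim: u => //= x u ->; rewrite mulw_push. Qed.

Lemma mulw0 u : reduced u -> mulw u [::] = u.
Proof.
by elim: u => //= x u IHu ru; rewrite IHu ?push_reduced//; exact: reduced_cons ru.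
Qed.

Lemma mulVw u : mulw (rev u) u = [::].
Proof.
by elim: u => //= x u IHu; rewrite rev_cons /mulw foldr_rcons /= eqxx.
Qed.

Lemma reduced_rev u : reduced u -> reduced (rev u).
Proof.
rewrite /reduced rev_sorted => ru; apply: sub_sorted ru => x y /=.
by rewrite eq_sym.
Qed.

Record dihedral := Dihedral { dword : seq bool; dwordP : reduced dword }.

HB.instance Definition _ := [isSub for dword].
HB.instance Definition _ := [Choice of dihedral by <:].

Definition dmul (u v : dihedral) : dihedral :=
  Dihedral (reduced_mulw (dword u) (dwordP v)).
Definition dunit : dihedral := @Dihedral [::] isT.
Definition dinv (u : dihedral) : dihedral := Dihedral (reduced_rev (dwordP u)).

Lemma dmulA : associative dmul.
Proof. by move=> u v w; apply/val_inj/mulwA/dwordP. Qed.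
Lemma dmul1 : left_id dunit dmul.
Proof. by move=> u; exact/val_inj. Qed.
Lemma dmulr1 : right_id dunit dmul.
Proof. by move=> u; apply/val_inj/mulw0/dwordP. Qed.
Lemma dmulV : left_inverse dunit dinv dmul.
Proof. by move=> u; apply/val_inj/mulVw. Qed.
Lemma dmulrV : right_inverse dunit dinv dmul.
Proof.
by move=> u; apply/val_inj; rewrite /= -[X in mulw X]revK mulVw.
Qed.

HB.instance Definition _ :=
  isGroup.Build dihedral dmulA dmul1 dmulr1 dmulV dmulrV.

Definition dlett (x : bool) : dihedral := @Dihedral [:: x] isT.
Definition da := dlett false.
Definition db := dlett true.

(* (dihedral, da, db) has the universal property of <a, b | a^2 = b^2 = 1>. *)
Lemma dihedral_relations : (da * da = 1 /\ db * db = 1)%g.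
Proof. by split; exact: val_inj. Qed.

Lemma dihedral_cons x w (rxw : reduced (x :: w)) :
  Dihedral rxw = (dlett x * Dihedral (reduced_cons rxw))%g.
Proof. by apply/val_inj; rewrite /= push_reduced. Qed.

Lemma dihedral_universal (H : groupType) (x y : H) :
  (x * x = 1)%g -> (y * y = 1)%g ->
  exists! f : dihedral -> H,
    [/\ {morph f : u v / (u * v)%g}, f da = x & f db = y].
Proof.
move=> xx yy; pose l b := if b then y else x.
have ll b : (l b * l b = 1)%g by case: b.
pose F (w : seq bool) : H := foldr (fun b h => (l b * h)%g) 1%g w.
have Fpush b w : F (push b w) = (l b * F w)%g.
  case: w => //= c w; have [->|//] := eqVneq b c.
  by rewrite mulgA ll mul1g.
exists (F \o dword); split => [|g [gM ga gb]].
  split; rewrite /= ?mulg1// => u v /=.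
  elim: (dword u) => /= [|b w IHw]; first by rewrite mul1g.
  by rewrite Fpush IHw mulgA.
have g1 : g 1%g = 1%g by apply: (mulgI (g 1%g)); rewrite -gM !mulg1.
have gl b : g (dlett b) = l b by case: b.
apply/funext => -[w]; elim: w => [rw|b w IHw rw] /=.
  by rewrite -g1; congr g; exact: val_inj.
by rewrite dihedral_cons gM gl -IHw.
Qed.

Definition Delta'_gens (k : nat) : set dihedral :=
  [set w | (2 <= size (dword w) <= 2 * k - 3)%N].

Lemma Delta'_finite k : finite_set (Delta'_gens k).
Proof.
pose N := (2 * k - 3).+1.
have fT : finite_set [set: N.-bseq bool] by exact: finite_finset.
have := finite_image (fun s : N.-bseq bool => insubd (1%g : dihedral) (s : seq bool)) fT.
apply: sub_finite_set => w /= /andP[_ sw].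
have sw' : (size (dword w) <= N)%N by exact: leqW.
by exists (Bseq sw') => //=; exact: valKd.
Qed.

Lemma Delta'_symmetric k s : Delta'_gens k s -> Delta'_gens k s^-1%g.
Proof. by rewrite /Delta'_gens/= size_rev. Qed.

Lemma Delta'_not1 k : ~ Delta'_gens k 1%g.
Proof. by []. Qed.

Lemma Delta'_generates k : (3 <= k)%N -> forall H : set dihedral,
  H 1%g -> (forall x y, H x -> H y -> H (x * y)%g) ->
  (forall x, H x -> H x^-1%g) ->
  Delta'_gens k `<=` H -> H = setT.
Proof.
move=> k3 H H1 HM _ SH.
have k33 : (3 <= 2 * k - 3)%N.
  by rewrite leq_subRL ?(leq_mul2l 2 3 k)//; exact: leq_trans k3 (leq_pmull _ _).
have Hl b : H (dlett b).
  have r2 : reduced [:: ~~ b; b] by case: (b).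
  have r3 : reduced [:: b; ~~ b; b] by case: (b).
  have -> : dlett b = (Dihedral r2 * Dihedral r3)%g.
    by apply/val_inj; case: b r2 r3.
  by apply: HM; apply: SH; rewrite /Delta'_gens/= ?k33 ?(ltnW k33).
apply/seteqP; split => // -[w rw] _; elim: w rw => [rw|b w IHw rw].
  by have -> : Dihedral rw = 1%g by exact: val_inj.
by rewrite dihedral_cons; apply: HM.
Qed.

Definition Delta' (k : nat) (hk : (3 <= k)%N) : markedGroup :=
  MarkedGroup (@Delta'_finite k) (@Delta'_symmetric k) (@Delta'_not1 k)
    (Delta'_generates hk).

(* Main.v *)
Require Import Defs.
From HB Require Import structures.
From mathcomp Require Import all_boot all_classical all_reals all_analysis.
From mathcomp Require Import zify.

(**
An orbit of the free part is a line on which [a] and [b] label alternate edges,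
and the shift graph joins the points of the line at distance between [2] and
[2k - 3]; no direction of the line is distinguished.

Lower bound. In a [k]-colouring of the line the maximal monochromatic runs have
at most two points and any [k] consecutive runs have distinct colours, so the
sequence of run colours is [k]-periodic. As [k >= 3], a boundary between runs
coloured [u, v] in one direction excludes a boundary coloured [v, u] in the same
direction. For a Borel colouring, Baire category yields a basic clopen set on
which the colours of three consecutive points are generically constant. It
meets its translate by a long word of odd length, which reverses the line, so
both kinds of boundary occur on one orbit.

Upper bound. Give [x] and [a x] the same colour; then the blocks [{x, a x}] at
block distance less than [k] must have distinct colours. Choose a locally
constant maximal discrete set of markers, colour periodically near each marker
in the direction it points to, and fill the bounded gaps in between: with
[k + 1] colours, words in which any [k] consecutive letters are distinct connect
any two windows in every sufficiently large length. Points that are close on an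
orbit are told apart by a locally constant index, which decides from which end a
gap is filled.
*)

Set Implicit Arguments.
Unset Strict Implicit.
Unset Printing Implicit Defensive.
Local Open Scope classical_set_scope.
Local Open Scope nat_scope.

(** * Runs of colours on a line *)

Section RunColours.
Variables (k : nat) (f : nat -> 'I_k).
Hypothesis k3 : 3 <= k.
Hypothesis f_proper : forall i j, i + 2 <= j <= i + (2 * k - 3) -> f i <> f j.
Hypothesis f01 : f 0 <> f 1.

(** If [e] ends a run, the next run has one or two points, because points at distance two have
    different colours. *)
Definition next_end e := if f e.+1 == f e.+2 then e.+2 else e.+1.
Definition run_end i := iter i next_end 0.

Lemma run_endS i : run_end i.+1 = next_end (run_end i). Proof. by []. Qed.

Lemma run_end_boundary i : f (run_end i) <> f (run_end i).+1.
Proof.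
elim: i => [//|i IHi]; rewrite run_endS /next_end.
case: eqP => [eqf|//]; rewrite -eqf; apply: f_proper; lia.
Qed.

Lemma run_colour i : f (run_end i).+1 = f (run_end i.+1).
Proof. by rewrite run_endS /next_end; case: eqP. Qed.

Lemma run_end_bounds i d : run_end i + d <= run_end (i + d) <= run_end i + 2 * d.
Proof.
elim: d => [|d IHd]; first by rewrite !addn0; lia.
rewrite (addnS i d) run_endS /next_end; case: ifP => _; lia.
Qed.

(** For [d >= 2] the last point of run [i] and the first point of run [i + d] are at least [2] and
    at most [2 * d - 1] apart, hence at most [2 * k - 3]. *)
Lemma run_colours_distinct i d : 0 < d < k -> f (run_end i) <> f (run_end (i + d)).
Proof.
case: d => // -[_|d ltdk].
  by rewrite addn1 -run_colour; apply: run_end_boundary.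
have := run_end_bounds i d.+1.
rewrite (addnS i d.+1) -run_colour => bnd; apply: f_proper; lia.
Qed.

(** Pigeonhole: the [k] runs after run [i] use every colour, and only the last of them can share the
    colour of run [i]. *)
Lemma run_colours_periodic i : f (run_end (i + k)) = f (run_end i).
Proof.
pose g (d : 'I_k) := f (run_end (i + d.+1)).
have g_inj : injective g.
  have lt_neq (d e : 'I_k) : d < e -> g d <> g e.
    move=> lde; rewrite /g.
    have -> : i + e.+1 = (i + d.+1) + (e - d) by lia.
    apply: run_colours_distinct; have := ltn_ord e; lia.
  move=> d e gde; apply: val_inj => /=.
  by case: (ltngtP d e) => // /lt_neq; rewrite gde.
have /codomP[d fid] : f (run_end i) \in codom g.
  exact: (inj_card_onto g_inj).
have [dk|dk] := eqVneq d.+1 k; first by rewrite fid /g dk.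
case: (@run_colours_distinct i d.+1); last by rewrite fid.
have := ltn_ord d; lia.
Qed.

Lemma run_colours_modn i : f (run_end i) = f (run_end (i %% k)).
Proof.
rewrite {1}(divn_eq i k); elim: (i %/ k) => [//|q <-].
by rewrite mulSn (addnC k) addnAC run_colours_periodic.
Qed.

Lemma run_colours_eq i j : f (run_end i) = f (run_end j) -> i = j %[mod k].
Proof.
rewrite run_colours_modn (run_colours_modn j).
have k0 : 0 < k by lia.
move: (ltn_pmod i k0) (ltn_pmod j k0).
move: (i %% k) (j %% k) => {}i {}j ik jk.
wlog lij : i j ik jk / i < j => [wlg|].
  case: (ltngtP i j) => // lij eqf; first exact: wlg.
  by apply/esym; apply: wlg.
have -> : j = i + (j - i) by lia.
by move/run_colours_distinct; case; lia.
Qed.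

Lemma boundary_run_end q : f q <> f q.+1 -> exists i, q = run_end i.
Proof.
move=> fq; have [m /andP[lem ltm]] : exists m, run_end m <= q < run_end m.+1.
  have exq : exists m, q < run_end m.
    by exists q.+1; have := run_end_bounds 0 q.+1; rewrite add0n; lia.
  case: (ex_minnP exq) => -[//|m] ltq min; exists m.
  by rewrite ltq andbT leqNgt; apply/negP => /min; lia.
exists m; move: ltm; rewrite run_endS /next_end.
case: eqP => [eqf|_]; last by lia.
have [->//|neq] := eqVneq q (run_end m) => ltq.
have qe : q = (run_end m).+1 by lia.
by case: fq; rewrite qe.
Qed.

(* The colours of successive runs are [k]-periodic and [k] consecutive ones are
   distinct, so the pair of colours at a boundary fixes a direction. *)
Lemma no_reversed_boundary q : f q = f 1 -> f q.+1 <> f 0.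
Proof.
move=> fq fq1; have [|i qE] := @boundary_run_end q.
  by rewrite fq fq1 => /esym.
have /run_colours_eq : f (run_end i) = f (run_end 1) by rewrite -qE fq -run_colour.
have /run_colours_eq : f (run_end i.+1) = f (run_end 0).
  by rewrite -run_colour -qE fq1.
(* The two congruences together give [2 = 0] modulo [k], impossible for [k >= 3]. *)
move=> i1 i0; move: i1.
by rewrite -(addn1 i) -modnDml i0 modnDml mod0n modn_small; lia.
Qed.

End RunColours.

(** * Words with distinct letters in every window *)

Section WindowWords.
Variable k : nat.
Hypothesis k_gt0 : 0 < k.

(* A state lists the last [k] colours used, oldest first, followed by the spare
   colour; the next colour is either the spare one or the oldest one. *)
Inductive window_path : nat -> seq nat -> seq nat -> Prop :=
| window_path0 s : window_path 0 s s
| window_path_spare n x w t :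
    window_path n (rcons w x) t -> window_path n.+1 (x :: w) t
| window_path_oldest n x w y t :
    window_path n (rcons (rcons w x) y) t ->
    window_path n.+1 (x :: rcons w y) t.

Lemma window_path_trans m n s t u :
  window_path m s t -> window_path n t u -> window_path (m + n) s u.
Proof.
elim=> {m s t} [//|m x w t _ IH /IH|m x w y t _ IH /IH].
  exact: window_path_spare.
exact: window_path_oldest.
Qed.

Lemma window_path_rotate p q : window_path (size p) (p ++ q) (q ++ p).
Proof.
elim: p q => [|x p IHp] q; first by rewrite cats0; exact: window_path0.
by rewrite cat_cons; apply: window_path_spare; rewrite rcons_cat -cat_rcons.
Qed.

Lemma window_path_rotate_oldest p q y :
  window_path (size p) (rcons (p ++ q) y) (rcons (q ++ p) y).
Proof.
elim: p q => [|x p IHp] q; first by rewrite cats0; exact: window_path0.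
rewrite cat_cons rcons_cons; apply: window_path_oldest.
by rewrite rcons_cat -cat_rcons.
Qed.

Lemma window_path_loop s : window_path (size s) s s.
Proof. by have := window_path_rotate s [::]; rewrite cats0. Qed.

Lemma window_path_loop_oldest s : size s = k.+1 -> window_path k s s.
Proof.
case/lastP: s => // s y; rewrite size_rcons => -[<-].
by have := window_path_rotate_oldest s [::] y; rewrite cats0.
Qed.

(** One full turn of rotations, except that [x] is reused at the moment when it is oldest and [z] is
    spare; this exchanges the two neighbours. *)
Lemma window_path_swap p z x q :
  window_path (size (p ++ z :: x :: q)) (p ++ z :: x :: q) (p ++ x :: z :: q).
Proof.
have -> : size (p ++ z :: x :: q) = size (rcons p z) + (size q).+1.
  by rewrite size_cat size_rcons /=; lia.
apply: (@window_path_trans _ _ _ ((x :: q) ++ rcons p z)).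
  by rewrite -cat_rcons; exact: window_path_rotate.
rewrite cat_cons -rcons_cat; apply: window_path_oldest.
have -> : rcons (rcons (q ++ p) x) z = q ++ (p ++ [:: x; z]).
  by rewrite -!cats1 -!catA.
have := window_path_rotate q (p ++ [:: x; z]).
by rewrite -catA.
Qed.

Lemma window_path_bubble p s1 y s2 :
  exists m, window_path (m * size (p ++ s1 ++ y :: s2))
    (p ++ s1 ++ y :: s2) (p ++ y :: s1 ++ s2).
Proof.
elim/last_ind: s1 s2 => [|s1 z IHs] s2; first by exists 0; exact: window_path0.
have [m IH] := IHs (z :: s2); exists m.+1; rewrite mulSn.
rewrite cat_rcons; apply: (@window_path_trans _ _ _ (p ++ s1 ++ y :: z :: s2)).
  by rewrite !catA; exact: window_path_swap.
by rewrite cat_rcons; move: IH; rewrite !size_cat.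
Qed.

Lemma window_path_perm p s t : perm_eq s t ->
  exists m, window_path (m * size (p ++ s)) (p ++ s) (p ++ t).
Proof.
elim: t p s => [|y t IHt] p s st.
  by exists 0; rewrite (perm_nilP st); exact: window_path0.
have ys : y \in s by rewrite (perm_mem st) mem_head.
case/splitPr: ys st => s1 s2 st.
have st' : perm_eq (s1 ++ s2) t.
  rewrite -(perm_cons y); apply: perm_trans st.
  by rewrite perm_sym -cat1s perm_catCA.
have [m path1] := window_path_bubble p s1 y s2.
have [m' path2] := IHt (rcons p y) _ st'.
exists (m + m'); rewrite mulnDl; apply: window_path_trans path1 _.
move: path2; rewrite !cat_rcons.
by congr window_path; rewrite !size_cat /= !size_cat /=; lia.
Qed.

(* [k] and [k + 1] are coprime, so loops of these lengths realise every large
   length. *)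
Lemma window_path_large s t : size s = k.+1 -> perm_eq s t ->
  exists N, forall n, N <= n -> window_path n s t.
Proof.
move=> sk st; have [m path_st] := @window_path_perm [::] s t st.
rewrite /= sk in path_st.
have loops i j : window_path (i * k + j * k.+1) s s.
  elim: i => [|i IHi].
    rewrite mul0n add0n; elim: j => [|j IHj]; first exact: window_path0.
    rewrite mulSn; apply: window_path_trans IHj.
    by rewrite -sk; exact: window_path_loop.
  rewrite mulSn -addnA; apply: window_path_trans IHi.
  exact: window_path_loop_oldest.
exists (k * k + m * k.+1) => n le_n.
pose d := n - m * k.+1.
(* From [d = q * k + r] follows [d = (q - r) * k + r * k.+1]; the summand [k * k] in the bound gives
   [r < k <= q]. *)
have dE : d = (d %/ k - d %% k) * k + d %% k * k.+1.
  have mk := ltn_pmod d k_gt0.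
  have : k <= d %/ k by rewrite leq_divRL// /d; lia.
  have := divn_eq d k; move: (d %/ k) (d %% k) mk => q r rk -> kq.
  rewrite mulnBl mulnS.
  have : r * k <= q * k by rewrite leq_mul2r; apply/orP; right; lia.
  lia.
have -> : n = d + m * k.+1 by rewrite /d subnK//; lia.
by apply: window_path_trans path_st; rewrite dE; exact: loops.
Qed.

(** The word lists the head of each state and ends with the final window. A head differs from the
    next [k - 1] letters because a state has no repetitions. *)
Lemma window_path_word n s t : window_path n s t -> size s = k.+1 -> uniq s ->
  exists f : nat -> nat,
  [/\ forall i, i < k -> f i = nth 0 s i,
      forall i, i < k -> f (n + i) = nth 0 t i,
      forall i, i < n + k -> f i \in s &
      forall i j, i < j -> j < n + k -> j < i + k -> f i <> f j].
Proof.
elim=> {n s t} [s|n x w t _ IH|n x w y t _ IH] sk us.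
- exists (nth 0 s); split => // [i ik|i j ij jk _].
    by apply: mem_nth; rewrite sk; lia.
  by move/eqP; rewrite nth_uniq ?sk//; lia.
- have [||f [f0 f1 f2 f3]] := IH.
    by rewrite size_rcons.
    by rewrite rcons_uniq.
  exists (fun i => if i is i'.+1 then f i' else x).
  have sub i : f i \in rcons w x -> f i \in x :: w by rewrite mem_rcons.
  split=> [[//|i] ik|i ik|[|i] ik|[|i] [|j] // ij jn jk].
  + rewrite f0 ?(ltnW ik)// nth_rcons; move: sk => [->].
    by rewrite (ltnW ik).
  + by rewrite addSn f1.
  + exact: mem_head.
  + by apply: sub; apply: f2; lia.
  + rewrite f0; last by lia.
    rewrite nth_rcons; move: sk => [sk].
    have jw : j < size w by lia.
    rewrite jw => xE; move: us => /= /andP[/negP xw _]; apply: xw.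
    by rewrite xE mem_nth.
  + by apply: f3; lia.
- have pr : perm_eq (rcons (rcons w x) y) (x :: rcons w y).
    by rewrite -!cats1 -catA -[x :: w ++ _]cat1s perm_sym perm_catCA.
  have [||f [f0 f1 f2 f3]] := IH.
    by rewrite (perm_size pr).
    by rewrite (perm_uniq pr).
  exists (fun i => if i is i'.+1 then f i' else x).
  have sw : (size w).+1 = k by move: sk => /=; rewrite size_rcons => -[].
  have nthf i : i < size w -> nth 0 (rcons (rcons w x) y) i = nth 0 (rcons w y) i.
    by move=> iw; rewrite !nth_rcons size_rcons iw ltnS (ltnW iw).
  split=> [[//|i] ik|i ik|[|i] ik|[|i] [|j] // ij jn jk].
  + by rewrite f0 ?(ltnW ik)//= nthf//; lia.
  + by rewrite addSn f1.
  + exact: mem_head.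
  + by rewrite -(perm_mem pr); apply: f2; lia.
  + rewrite f0; last by lia.
    have jw : j < size w by lia.
    rewrite nthf// => xE; move: us => /= /andP[/negP xw _]; apply: xw.
    by rewrite xE mem_nth// size_rcons ltnS ltnW.
  + by apply: f3; lia.
Qed.

(* The colour at distance [i] from a marker, on the side it points away from
   ([o = true]) or points to ([o = false]). *)
Definition marker_colour (o : bool) (i : nat) := if o then (k - i) %% k else i.

Lemma marker_colour0 o : marker_colour o 0 = 0.
Proof. by rewrite /marker_colour subn0 modnn; case: o. Qed.

Lemma marker_colour_neq o i j : 0 < i + j -> i + j < k ->
  marker_colour o i <> marker_colour (~~ o) j.
Proof.
wlog: o i j / o => [wlg|-> ].
  case: o => [|ij ijk]; first exact: wlg.
  by apply/nesym; apply: (wlg true); rewrite // addnC.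
rewrite /marker_colour /=; case: i => [|i] ij ijk.
  by rewrite subn0 modnn; lia.
by rewrite modn_small; lia.
Qed.

Lemma gap_filling : exists N, forall L, N <= L -> forall o1 o2 : bool,
  exists f : nat -> nat,
  [/\ forall i, i <= L -> f i <= k,
      forall i j, i < j -> j <= L -> j < i + k -> f i <> f j,
      forall i, i < k -> f i = marker_colour o1 i &
      forall i, i < k -> f (L - i) = marker_colour o2 i].
Proof.
(* At the left end the window is read away from the marker, at the right end towards it, hence the
   reversal; colour [k] is spare at both ends. *)
pose S o := rcons (mkseq (marker_colour o) k) k.
pose S' o := rcons (rev (mkseq (marker_colour o) k)) k.
have permS o : perm_eq (mkseq (marker_colour o) k) (iota 0 k).
  rewrite perm_sym uniq_perm ?iota_uniq//.
    rewrite map_inj_in_uniq ?iota_uniq// => i j.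
    rewrite !mem_iota !add0n /= => ik jk.
    case: o; rewrite /marker_colour//.
    case: i ik => [|i]; case: j jk => [|j] // jk ik;
      rewrite ?subn0 ?modnn ?modn_small; lia.
  move=> i; rewrite mem_iota add0n /=; apply/idP/mapP => [ik|[j]].
    exists (marker_colour o i).
      rewrite mem_iota add0n /=; case: o; rewrite /marker_colour ?ltn_pmod//.
    case: o; rewrite /marker_colour//; case: i ik => [|i] ik.
      by rewrite subn0 modnn subn0 modnn.
    by rewrite (@modn_small (k - i.+1)) ?modn_small; lia.
  rewrite mem_iota add0n /= => jk ->.
  by case: o; rewrite /marker_colour ?ltn_pmod.
have permS1 o : perm_eq (S o) (iota 0 k.+1).
  by rewrite -addn1 iotaD /S -cats1 perm_cat2r.
have permS2 o : perm_eq (S' o) (iota 0 k.+1).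
  rewrite -addn1 iotaD /S' -cats1 perm_cat2r.
  by apply: perm_trans (permS o); rewrite perm_rev.
have pathS o1 o2 : exists N, forall n, N <= n -> window_path n (S o1) (S' o2).
  apply: window_path_large; first by rewrite (perm_size (permS1 _)) size_iota.
  by apply: perm_trans (permS1 _) _; rewrite perm_sym.
have [N NP] : exists N, forall o1 o2 n, N <= n -> window_path n (S o1) (S' o2).
  have [N1 P1] := pathS true true; have [N2 P2] := pathS true false.
  have [N3 P3] := pathS false true; have [N4 P4] := pathS false false.
  exists (N1 + N2 + N3 + N4) => -[] [] n le_n.
  - apply: P1; lia.
  - apply: P2; lia.
  - apply: P3; lia.
  - apply: P4; lia.
exists (N + k) => L le_L o1 o2.
(* A path of [n] steps spells [n + k] letters, and positions [0] to [L] require [n + k = L + 1]. *)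
have [|||f [f0 f1 f2 f3]] := window_path_word (NP o1 o2 (L - k.-1) _).
- by lia.
- by rewrite (perm_size (permS1 _)) size_iota.
- by rewrite (perm_uniq (permS1 _)) iota_uniq.
exists f; split=> [i iL|i j ij jL jk|i ik|i ik].
- have /f2 : i < L - k.-1 + k by lia.
  by rewrite (perm_mem (permS1 _)) mem_iota ltnS => /andP[].
- by apply: f3; lia.
- by rewrite f0// nth_rcons size_mkseq ik nth_mkseq.
- have -> : L - i = L - k.-1 + (k - i.+1) by lia.
  have ik' : k - i.+1 < k by lia.
  rewrite f1// nth_rcons size_rev size_mkseq ik' nth_rev size_mkseq//.
  by rewrite nth_mkseq; last lia; congr marker_colour; lia.
Qed.

End WindowWords.

(** * The shift action and its cylinders *)

Section Shift.
Variable G : groupType.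
Implicit Types (g h : G) (x : shift_space G).

Lemma shift_act1 x : shift_act 1%g x = x.
Proof. by apply/funext => h; rewrite /shift_act invg1 mul1g. Qed.

Lemma shift_actM g h x : shift_act (g * h)%g x = shift_act g (shift_act h x).
Proof. by apply/funext => u; rewrite /shift_act invgM mulgA. Qed.

Lemma free_part_shift g x : free_part G x -> free_part G (shift_act g x).
Proof.
move=> fx h h1 hgx; apply: (fx (g^-1 * h * g)%g).
  move=> /(congr1 (fun u => g * u * g^-1)%g).
  by rewrite !mulgA mulgV mul1g mulgK mulg1 mulgV.
by rewrite !shift_actM hgx -shift_actM mulVg shift_act1.
Qed.

Definition shift_free g (x : free_part G) : free_part G :=
  exist _ (shift_act g (val x)) (mem_set (free_part_shift (set_valP x))).

Lemma val_shift_free g (x : free_part G) :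
  val (shift_free g x) = shift_act g (val x).
Proof. by []. Qed.

End Shift.

Section Cylinders.
Variable G : groupType.
Implicit Types (x y : shift_space G).

(* The condition [(F, v)] prescribes the values of the indicator function of
   [v] on [F]; this way every pair of lists is consistent. *)
Definition cylinder (p : seq G * seq G) : set (shift_space G) :=
  [set x | {in p.1, forall h, x h = (h \in p.2)}].

Definition restriction x (F : seq G) := (F, [seq h <- F | x h]).

Lemma cylinder_restriction x F y :
  cylinder (restriction x F) y <-> {in F, y =1 x}.
Proof.
by split=> xy h hF; rewrite xy// mem_filter hF andbT.
Qed.

Lemma cylinder_point (p : seq G * seq G) : cylinder p (fun h => h \in p.2).
Proof. by move=> h. Qed.

Lemma open_cylinder p : open (cylinder p).
Proof.
case: p => F v; elim: F => [|h F IHF].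
  by have -> : cylinder ([::], v) = setT; [exact/seteqP|exact: openT].
have -> : cylinder (h :: F, v) =
    (proj h : shift_space G -> bool) @^-1` [set (h \in v)] `&` cylinder (F, v).
  apply/seteqP; split=> [x xp|x [xh xF] u /=].
    split; first by rewrite /= /proj; apply: (xp h); exact: mem_head.
    by move=> u uF; apply: (xp u); rewrite /= inE uF orbT.
  by rewrite inE => /orP[/eqP->//|/xF].
apply: openI => //; apply: open_comp => [x _|]; first exact: proj_continuous.
exact: discrete_open.
Qed.

(** Agreement with [x] on finite sets generates a filter converging to [x] in the product
    topology. *)
Lemma open_shiftP (V : set (shift_space G)) x : open V -> V x ->
  exists F : seq G, forall y, {in F, y =1 x} -> V y.
Proof.
move=> oV Vx.
pose B (F : seq G) := [set y : shift_space G | {in F, y =1 x}].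
pose Phi := filter_from [set: seq G] B.
have Phi_filter : Filter Phi.
  apply: filter_from_filter; first by exists [::].
  move=> F1 F2 _ _; exists (F1 ++ F2) => // y yx; split=> h hF; apply: yx;
    by rewrite mem_cat hF ?orbT.
have Phi_cvg : Phi --> x.
  apply/cvg_sup => h A; rewrite nbhsE => -[_ [[C oC <-] Cx] CA].
  exists [:: h] => // y yx; apply: CA => /=.
  by rewrite yx ?mem_head.
have : Phi V by apply: Phi_cvg; exact: open_nbhs_nbhs.
by case=> F _ FV; exists F => y; exact: FV.
Qed.

Definition translate (g : G) (p : seq G * seq G) :=
  ([seq (g^-1 * h)%g | h <- p.1], [seq (g^-1 * h)%g | h <- p.2]).

Lemma cylinder_translate g p x :
  cylinder (translate g p) x <-> cylinder p (shift_act g x).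
Proof.
split=> xp h hp.
  rewrite /shift_act xp ?mem_map//=; first exact: mulgI.
  exact: mulgI.
case/mapP: hp => u up ->; rewrite mem_map; last exact: mulgI.
by rewrite -(xp u up).
Qed.

End Cylinders.

HB.instance Definition _ := [Countable of dihedral by <:].

(** * Baire category *)

Section Category.

Local Notation cond := (seq dihedral * seq dihedral)%type.
Local Notation X := (shift_space dihedral).
Implicit Types (p q : cond) (C : set X).

(** Each [D n] is a dense family of conditions, so the union of its cylinders is dense open, and [C]
    contains the intersection of these unions. *)
Definition comeagre C := exists2 D : nat -> set cond,
  (forall n p, exists2 q, cylinder q `<=` cylinder p & D n q) &
  forall x, (forall n, exists2 q, D n q & cylinder q x) -> C x.

Lemma comeagre_dense C :
  (forall p, exists2 q, cylinder q `<=` cylinder p & cylinder q `<=` C) ->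
  comeagre C.
Proof.
move=> dC; exists (fun _ q => cylinder q `<=` C); first by move=> _; exact: dC.
by move=> x /(_ 0%N)[q qC] /qC.
Qed.

Lemma comeagreT : comeagre setT.
Proof. by apply: comeagre_dense => p; exists p. Qed.

Lemma comeagre_bigcap (I : countType) (C : I -> set X) :
  (forall i, comeagre (C i)) -> comeagre (\bigcap_i C i).
Proof.
move=> cC; have /choice[D DP] : forall i, exists D : nat -> set cond,
    (forall n p, exists2 q, cylinder q `<=` cylinder p & D n q) /\
    forall x, (forall n, exists2 q, D n q & cylinder q x) -> C i x.
  by move=> i; have [D D1 D2] := cC i; exists D.
exists (fun n => if @unpickle (I * nat)%type n is Some im then D im.1 im.2
                 else setT).
  move=> n p; case: unpickle => [[i m]|]; last by exists p.
  by have [+ _] := DP i; exact.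
move=> x xD i _; have [_] := DP i; apply=> m.
by have := xD (pickle (i, m)); rewrite pickleK.
Qed.

Lemma comeagreI C1 C2 : comeagre C1 -> comeagre C2 -> comeagre (C1 `&` C2).
Proof.
move=> c1 c2; have := @comeagre_bigcap bool (fun b => if b then C1 else C2).
rewrite (_ : \bigcap_b _ = C1 `&` C2); first by apply; case.
apply/seteqP; split=> [x xC|x [x1 x2] [] _//].
by split; [exact: (xC true)|exact: (xC false)].
Qed.

(** The Baire category theorem: stage [n] refines the condition into [D n] and also fixes the
    coordinate with code [n], so the chain of conditions determines a point. *)
Lemma comeagre_meets C p : comeagre C -> exists2 x, cylinder p x & C x.
Proof.
case=> D dD DC.
have ext (u : cond * nat) : exists q, [/\ cylinder q `<=` cylinder u.1,
    exists2 q0, D u.2 q0 & cylinder q `<=` cylinder q0 &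
    forall h : dihedral, pickle h = u.2 -> h \in q.1].
  have [q0 q0u Dq0] := dD u.2 u.1.
  pose e := if @unpickle dihedral u.2 is Some h then [:: h] else [::].
  pose q := restriction (fun h => h \in q0.2) (e ++ q0.1).
  have qq0 : cylinder q `<=` cylinder q0.
    by move=> x /cylinder_restriction xq h hq; rewrite xq// mem_cat hq orbT.
  exists q; split; first exact: subset_trans q0u.
    by exists q0.
  by move=> h hu; rewrite /q /= /e -hu pickleK mem_head.
have [next nextP] := choice ext.
pose P := fix P n := if n is m.+1 then next (P m, m) else p.
have PS n : cylinder (P n.+1) `<=` cylinder (P n) by case: (nextP (P n, n)).
have Ple m n : (m <= n)%N -> cylinder (P n) `<=` cylinder (P m).
  move=> /subnK <-; elim: (n - m)%N => [//|d IHd].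
  by rewrite addSn; apply: subset_trans (PS _) IHd.
pose x : X := fun h => h \in (P (pickle h).+1).2.
have xP n : cylinder (P n) x.
  move=> h hn; rewrite /x; set N := (pickle h).+1.
  have hN : h \in (P N).1 by case: (nextP (P (pickle h), pickle h)) => _ _; exact.
  case: (leqP n N) => [/Ple nN|/ltnW/Ple nN].
    exact: (nN _ (@cylinder_point _ (P N)) h hn).
  by rewrite -(nN _ (@cylinder_point _ (P n)) h hN).
exists x; first exact: (xP 0%N).
apply: DC => n; case: (nextP (P n, n)) => _ [q0 Dq0 qq0] _.
by exists q0 => //; apply: qq0; exact: (xP n.+1).
Qed.

Lemma comeagre_shift g C : comeagre C -> comeagre (shift_act g @^-1` C).
Proof.
case=> D dD DC; exists (fun n => translate g @` D n) => [n p|x xD].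
  have [q qp Dq] := dD n (translate g^-1%g p).
  exists (translate g q); last by exists q.
  move=> x /cylinder_translate/qp/cylinder_translate.
  by rewrite -shift_actM mulVg shift_act1.
apply: DC => n; have [_ [q Dq <-] /cylinder_translate xq] := xD n.
by exists q.
Qed.

Lemma size_mulw u v : (size (mulw u v) <= size u + size v)%N.
Proof.
elim: u => [//|b u IHu] /=; rewrite addSn.
apply: leq_trans (_ : (size (mulw u v)).+1 <= _)%N => //.
by case: (mulw u v) => [|c w] //=; case: ifP => _ //=; rewrite ltnW.
Qed.

(** For each of the countably many [g <> 1], a condition can be extended so that [x] takes different
    values at [h] and [g^-1 * h]. *)
Lemma comeagre_free : comeagre (free_part dihedral).
Proof.
have -> : free_part dihedral = \bigcap_g
    [set x : X | g <> 1%g -> shift_act g x <> x].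
  by apply/seteqP; split=> [x fx g _|x fx g]; [exact: fx|exact: (fx g I)].
apply: comeagre_bigcap => g; apply: comeagre_dense => p.
have [->|g1] := eqVneq g 1%g; first by exists p => // x _ /= /(_ erefl).
(* Outside [E], both [h] and [g^-1 * h] avoid the domain of [p]; an alternating word longer than all
   of [E] supplies such an [h]. *)
pose E := p.1 ++ [seq (g * h)%g | h <- p.1].
have [h hE] : exists h, h \notin E.
  pose N := (\max_(u <- E) size (dword u)).+1.
  have rN : reduced (mkseq odd N).
    apply/(sortedP false) => i; rewrite size_mkseq => iN.
    by rewrite !nth_mkseq ?(ltnW iN)//=; case: odd.
  exists (Dihedral rN); apply/negP => hE.
  have : (size (mkseq odd N) <= \max_(u <- E) size (dword u))%N.
    exact: (@leq_bigmax_seq _ E xpredT (fun u => size (dword u)) _ hE isT).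
  by rewrite size_mkseq ltnn.
move: hE; rewrite mem_cat negb_or => /andP[hp hgp].
have ghp : (g^-1 * h)%g \notin p.1.
  by apply: contra hgp => /(map_f (fun u => g * u)%g); rewrite mulVKg.
have ghh : (g^-1 * h)%g != h.
  apply: contra g1 => /eqP ghh; apply/eqP.
  by rewrite -[g]invgK -(mulgK h g^-1%g) ghh mulgV invg1.
pose y : X := fun u => if u == h then true
  else if u == (g^-1 * h)%g then false else u \in p.2.
exists (restriction y (h :: (g^-1 * h)%g :: p.1)) => x /cylinder_restriction xy.
  move=> u up; rewrite xy ?inE ?up ?orbT// /y.
  have [uh|_] := eqVneq u h; first by rewrite -uh up in hp.
  by have [uh|//] := eqVneq u (g^-1 * h)%g; rewrite -uh up in ghp.
move=> _ /(congr1 (fun z : X => z h)); rewrite /shift_act.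
by rewrite !xy ?inE ?eqxx ?orbT// /y (negbTE ghh) !eqxx.
Qed.

(** * Forcing and the Baire property of Borel sets *)

Definition forces p (B : set (free_part dihedral)) := exists2 C, comeagre C &
  forall x : free_part dihedral, cylinder p (val x) -> C (val x) -> B x.

(** A form of the Baire property: below every condition there is one on whose cylinder [B] or its
    complement is comeagre, relative to the free part. *)
Definition decided (B : set (free_part dihedral)) := forall p, exists2 q,
  cylinder q `<=` cylinder p & forces q B \/ forces q (~` B).

Lemma forces_sub p q B : cylinder q `<=` cylinder p -> forces p B -> forces q B.
Proof. by move=> qp [C cC CB]; exists C => // x /qp; exact: CB. Qed.

Lemma forcesI p B1 B2 : forces p B1 -> forces p B2 -> forces p (B1 `&` B2).
Proof.
move=> [C1 c1 B1P] [C2 c2 B2P]; exists (C1 `&` C2); first exact: comeagreI.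
by move=> x xp [x1 x2]; split; [exact: B1P|exact: B2P].
Qed.

Lemma forces_meets p B : forces p B -> exists2 x, cylinder p (val x) & B x.
Proof.
move=> [C cC CB].
have [x xp [xC fx]] := comeagre_meets p (comeagreI cC comeagre_free).
pose xf : free_part dihedral := exist _ x (mem_set fx).
by exists xf => //; exact: CB.
Qed.

(** When no [B n] is forced below [p], a generic point of [p] lies, for every [n], in a cylinder
    forcing the complement of [B n]. Conditions are countable, so all exceptional meagre sets can be
    discarded together. *)
Lemma decided_bigcup (B : nat -> set (free_part dihedral)) :
  (forall n, decided (B n)) -> decided (\bigcup_n B n).
Proof.
move=> dB p; have [[n [q qp [C cC CB]]]|noq] := pselect
    (exists n, exists2 q, cylinder q `<=` cylinder p & forces q (B n)).
  by exists q => //; left; exists C => // x xq xC; exists n => //; exact: CB.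
exists p => //; right.
(* No condition below [p] forces any [B n], so the conditions forcing their
   complements are dense below [p]. *)
pose K (nr : nat * cond) := if pselect (forces nr.2 (~` B nr.1)) is left f
  then s2val (cid2 f) else setT.
have cK nr : comeagre (K nr).
  rewrite /K; case: pselect => [f|_]; first exact: (s2valP (cid2 f)).
  exact: comeagreT.
have KP n r (x : free_part dihedral) : forces r (~` B n) -> cylinder r (val x) ->
    K (n, r) (val x) -> ~ B n x.
  by rewrite /K /=; case: pselect => //= f _; exact: (s2valP' (cid2 f) x).
pose Dn n := [set x : X | cylinder p x ->
  exists2 r, forces r (~` B n) & cylinder r x].
have cD n : comeagre (Dn n).
  apply: comeagre_dense => r.
  have [[x [xr xp]]|nrp] := pselect (exists x, cylinder r x /\ cylinder p x).
    pose s := restriction x (r.1 ++ p.1).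
    have sr : cylinder s `<=` cylinder r.
      by move=> y /cylinder_restriction yx h hr; rewrite yx ?xr// mem_cat hr.
    have sp : cylinder s `<=` cylinder p.
      by move=> y /cylinder_restriction yx h hr; rewrite yx ?xp// mem_cat hr orbT.
    have [q qs [qB|qB]] := dB n s.
      by case: noq; exists n, q => //; exact: subset_trans sp.
    by exists q => [|y yq _]; [exact: subset_trans sr|exists q].
  by exists r => // x xr xp; case: nrp; exists x.
exists ((\bigcap_n Dn n) `&` (\bigcap_nr K nr)).
  by apply: comeagreI; exact: comeagre_bigcap.
move=> x xp [xD xK] [n _ Bnx].
have [r rB xr] := xD n I xp.
exact: KP rB xr (xK (n, r) I) Bnx.
Qed.

Lemma borel_decided (B : set (free_part dihedral)) : borel_set B -> decided B.
Proof.
apply: smallest_sub => [|U [V oV <-] p]; last first.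
  have [[x [xp xV]]|npV] := pselect (exists x, cylinder p x /\ V x).
    have [F FV] := open_shiftP oV xV.
    exists (restriction x (p.1 ++ F)) => [y|].
      move=> /cylinder_restriction yx h hp.
      by rewrite yx ?xp// mem_cat hp.
    left; exists setT; first exact: comeagreT.
    move=> y /cylinder_restriction yx _; apply: FV => h hF.
    by apply: yx; rewrite mem_cat hF orbT.
  exists p => //; right; exists setT; first exact: comeagreT.
  by move=> x xp _ xV; apply: npV; exists (val x).
split=> [p|U dU p|U dU]; last exact: decided_bigcup.
  exists p => //; right; exists setT; first exact: comeagreT.
  by move=> x _ _ [].
have [q qp [qU|qU]] := dU p; exists q => //; rewrite setTD; [right|left] => //.
by rewrite setCK.
Qed.

Lemma decided_shift g B : decided B -> decided (shift_free g @^-1` B).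
Proof.
move=> dB p; have [q qp qB] := dB (translate g^-1%g p).
exists (translate g q).
  move=> x /cylinder_translate/qp/cylinder_translate.
  by rewrite -shift_actM mulVg shift_act1.
case: qB => -[C cC CB]; [left|right];
  exists (shift_act g @^-1` C); do ?exact: comeagre_shift;
  by move=> x /cylinder_translate xq xC; exact: (CB (shift_free g x)).
Qed.

Lemma decided_value (n : nat) (c : free_part dihedral -> 'I_n) p :
  (forall a, decided (c @^-1` [set a])) ->
  exists2 q, cylinder q `<=` cylinder p & exists a, forces q (c @^-1` [set a]).
Proof.
(* The list [s] holds the colours excluded so far. Excluding all of them is impossible, as a forced
   set has a point. *)
move=> dc; suff H (s : seq 'I_n) : exists2 q, cylinder q `<=` cylinder p &
    (exists a, forces q (c @^-1` [set a])) \/ forces q [set x | c x \notin s].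
  have [q qp [qa|/forces_meets[x _]]] := H (enum 'I_n); first by exists q.
  by rewrite /= mem_enum.
elim: s => [|a s [q qp [[b qb]|qs]]].
- by exists p => //; right; exists setT => //; exact: comeagreT.
- by exists q => //; left; exists b.
have [r rq [ra|ra]] := dc a q; exists r; do ?exact: subset_trans qp.
  by left; exists a.
right; have [C cC CB] := forcesI ra (forces_sub rq qs).
exists C => // x xr /(CB _ xr)[xa xs] /=.
by rewrite inE negb_or xs andbT; apply/eqP.
Qed.

End Category.

(** * The lower bound *)

Fixpoint alternating (b : bool) (n : nat) : seq bool :=
  if n is m.+1 then b :: alternating (~~ b) m else [::].

Lemma size_alternating b n : size (alternating b n) = n.
Proof. by elim: n b => //= n IHn b; rewrite IHn. Qed.

Lemma reduced_alternating b n : reduced (alternating b n).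
Proof.
elim: n b => [//|[//|n] IHn] b.
by apply/andP; split; [case: b|exact: (IHn (~~ b))].
Qed.

Lemma reducedP w : reduced w -> w = alternating (head false w) (size w).
Proof.
elim: w => [//|b [|c w] IHw] // rw; have := IHw (reduced_cons rw).
have -> : c = ~~ b.
  by move: rw; rewrite /reduced /= => /andP[+ _]; case: b c {IHw} => -[].
by move=> E; congr cons.
Qed.

Definition dalt b n := Dihedral (reduced_alternating b n).

Lemma dihedralP (s : dihedral) : exists b, s = dalt b (size (dword s)).
Proof.
by exists (head false (dword s)); apply/val_inj/reducedP/dwordP.
Qed.

Lemma dalt0 b : dalt b 0 = 1%g.
Proof. exact/val_inj. Qed.

Lemma daltS b n : dalt b n.+1 = (dlett b * dalt (~~ b) n)%g.
Proof.
apply/val_inj => /=; rewrite push_reduced//; exact: (reduced_alternating b n.+1).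
Qed.

Lemma dlettK b (g : dihedral) : (dlett b * (dlett b * g))%g = g.
Proof.
by rewrite mulgA; case: dihedral_relations => a1 b1; case: b; rewrite ?a1 ?b1 mul1g.
Qed.

(* The element sending a point to its [i]-th successor on its orbit, in the
   direction where the first step is [a]. *)
Definition dstep i := dalt (~~ odd i) i.

Lemma dstepD i d : dstep (i + d) = (dalt (~~ odd (i + d)) d * dstep i)%g.
Proof.
elim: d => [|d IHd]; first by rewrite addn0 dalt0 mul1g.
by rewrite addnS /dstep /= negbK !daltS -/(dstep _) IHd mulgA.
Qed.

Lemma dstepS i : dstep i.+1 = (dlett (odd i) * dstep i)%g.
Proof. by rewrite /dstep /= negbK daltS. Qed.

(** A word of odd length acts as a reflection of the line, so successors of the image are
    predecessors seen from the original point. *)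
Lemma dstep_rev i j : odd j -> (i <= j)%N -> (dstep i * dstep j)%g = dstep (j - i).
Proof.
move=> oj; elim: i => [_|i IHi ltij]; first by rewrite subn0 /dstep dalt0 mul1g.
rewrite dstepS -mulgA IHi ?(ltnW ltij)//.
have -> : (j - i)%N = (j - i.+1).+1 by lia.
rewrite dstepS; have -> : odd (j - i.+1) = odd i; last exact: dlettK.
by rewrite oddB//= oj; case: odd.
Qed.

Lemma shift_graph_step k (hk : (3 <= k)%N) (x : free_part dihedral) i j :
  (i + 2 <= j <= i + (2 * k - 3))%N ->
  @shift_graph (Delta' hk) (shift_free (dstep i) x) (shift_free (dstep j) x).
Proof.
move=> ij; have -> : j = (i + (j - i))%N by lia.
set d := (j - i)%N; have d_gt0 : (2 <= d <= 2 * k - 3)%N by lia.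
pose s : dihedral := dalt (~~ odd (i + d)) d.
have sx : shift_act s (val (shift_free (dstep i) x)) =
    val (shift_free (dstep (i + d)) x).
  by rewrite !val_shift_free -shift_actM dstepD.
split; last by exists s; rewrite //= /Delta'_gens /= size_alternating.
move=> /(congr1 val); rewrite -sx => /esym.
apply: (set_valP (shift_free (dstep i) x)).
by move=> /(congr1 (size \o dword)) /=; rewrite size_alternating; lia.
Qed.

(** If [g] is longer than twice every word in the domain of [p], that domain is disjoint from its
    translate by [g^-1], and the two conditions can be merged. *)
Lemma cylinder_far_translate (p : seq dihedral * seq dihedral) :
  exists N, forall g : dihedral, (N < size (dword g))%N -> exists q,
  cylinder q `<=` cylinder p `&` shift_act g @^-1` cylinder p.
Proof.
pose M := (\max_(u <- p.1) size (dword u))%N.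
have leM u : u \in p.1 -> (size (dword u) <= M)%N.
  by move=> up; exact: (@leq_bigmax_seq _ p.1 xpredT (fun u => size (dword u))).
exists (M + M)%N => g ltg.
have far h : h \in p.1 -> (g^-1 * h)%g \notin p.1.
  move=> hp; apply/negP => ghp; have gE : g = (h * (g^-1 * h)^-1)%g.
    by rewrite invgM invgK mulVKg.
  move: ltg; rewrite gE ltnNge => /negP; apply.
  apply: leq_trans (size_mulw _ _) _; apply: leq_add; first exact: leM.
  by rewrite size_rev; exact: leM.
pose y : shift_space dihedral := fun h =>
  if h \in p.1 then h \in p.2 else (g * h)%g \in p.2.
exists (restriction y (p.1 ++ [seq (g^-1 * h)%g | h <- p.1])) => x.
move=> /cylinder_restriction xy; split=> h hp.
  by rewrite xy ?mem_cat ?hp// /y hp.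
rewrite /shift_act xy /y ?(negbTE (far h hp)) ?mulVKg//.
by rewrite mem_cat map_f ?orbT.
Qed.

(* A condition deciding the colours of three consecutive points is compatible
   with its translate by a long odd word, which reverses the orbit. *)
Lemma shift_graph_not_colorable k (hk : (3 <= k)%N) :
  ~ borel_colorable (@shift_graph (Delta' hk)) k.
Proof.
move=> [c0 borel_c proper_c0].
pose c : free_part dihedral -> 'I_k := c0.
have proper_c i j x : (i + 2 <= j <= i + (2 * k - 3))%N ->
    c (shift_free (dstep i) x) <> c (shift_free (dstep j) x).
  by move=> ij; apply: proper_c0; exact: shift_graph_step.
pose ci i := c \o shift_free (dstep i).
have dec i a : decided (ci i @^-1` [set a]).
  apply: (@decided_shift _ (c @^-1` [set a])).
  exact: (borel_decided (borel_c [set a])).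
have [p0 _ [a0 f0]] := decided_value ([::], [::]) (dec 0%N).
have [p1 p10 [a1 f1]] := decided_value p0 (dec 1%N).
have [p p21 [a2 f2]] := decided_value p1 (dec 2%N).
pose a i := nth a0 [:: a0; a1; a2] i.
have [C cC CP] : forces p [set x | forall i, (i <= 2)%N -> ci i x = a i].
  have [C cC CB] := forcesI (forces_sub (subset_trans p21 p10) f0)
    (forcesI (forces_sub p21 f1) f2).
  by exists C => // x xp /(CB _ xp)[x0 [x1 x2]] [|[|[|i]]].
have [N NP] := cylinder_far_translate p.
pose j := (N + 2).*2.+1.
have oj : odd j by rewrite /= odd_double.
have [|q qp] := NP (dstep j); first by rewrite size_alternating /j; lia.
have [x /qp[xp xjp] [[xC xjC] xf]] := comeagre_meets q
  (comeagreI (comeagreI cC (comeagre_shift (dstep j) cC)) comeagre_free).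
pose xf' : free_part dihedral := exist _ x (mem_set xf).
pose f i := ci i xf'.
have fa i : (i <= 2)%N -> f i = a i by exact: CP.
have fj i : (i <= 2)%N -> f (j - i)%N = a i.
  move=> i2; rewrite -(CP (shift_free (dstep j) xf'))// /f /ci /=.
  congr c; apply/val_inj => /=; rewrite -shift_actM dstep_rev//.
  by rewrite /j; lia.
have f_proper i i' : (i + 2 <= i' <= i + (2 * k - 3))%N -> f i <> f i'.
  exact: proper_c.
(* One of the pairs [0, 1] and [1, 2] is a boundary; its reversed copy starts at [j - 1] or [j - 2]
   respectively. The second case is the first with indices moved by one. *)
have f02 : f 0%N <> f 2%N by apply: f_proper; lia.
have [f01|f01] := eqVneq (f 0%N) (f 1%N); last first.
  apply: (@no_reversed_boundary k f _ f_proper _ (j - 1)) => //.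
  - exact/eqP.
  - by rewrite fj// -fa.
  - have -> : (j - 1).+1 = (j - 0)%N by rewrite /j; lia.
    by rewrite fj// -fa.
apply: (@no_reversed_boundary k (fun i => f i.+1) _ _ _ (j - 3)) => //.
- by move=> i i' ii'; apply: f_proper; lia.
- by rewrite -f01.
- have -> : (j - 3).+1 = (j - 2)%N by rewrite /j; lia.
  by rewrite fj// -fa.
- have -> : (j - 3).+2 = (j - 1)%N by rewrite /j; lia.
  by rewrite fj// -fa.
Qed.

(** * Locally constant markers *)

Local Notation X := (shift_space dihedral).

Definition locally_constant_at (T : Type) (f : X -> T) (x : X) :=
  exists F : seq dihedral,
  forall y, free_part dihedral y -> {in F, y =1 x} -> f y = f x.

Definition locally_constant (T : Type) (f : X -> T) :=
  forall x, free_part dihedral x -> locally_constant_at f x.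

Lemma locally_constant_at_shift T (f : X -> T) g x :
  locally_constant_at f (shift_act g x) ->
  locally_constant_at (f \o shift_act g) x.
Proof.
move=> [F FP]; exists [seq (g^-1 * h)%g | h <- F] => y fy yx.
apply: FP => [|h hF]; first exact: free_part_shift.
by apply: yx; exact: map_f.
Qed.

Lemma locally_constant_shift T (f : X -> T) g :
  locally_constant f -> locally_constant (f \o shift_act g).
Proof.
by move=> lf x fx; apply: locally_constant_at_shift; apply/lf/free_part_shift.
Qed.

Lemma locally_constant_at_all (I : eqType) (T : Type) (f : I -> X -> T)
    (s : seq I) x :
  {in s, forall i, locally_constant_at (f i) x} ->
  exists F : seq dihedral, forall y, free_part dihedral y -> {in F, y =1 x} ->
    {in s, forall i, f i y = f i x}.
Proof.
elim: s => [_|i s IHs lf]; first by exists [::].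
have [|F FP] := IHs; first by move=> j js; apply: lf; rewrite inE js orbT.
have [F' F'P] := lf i (mem_head _ _).
exists (F' ++ F) => y fy yx j; rewrite inE => /orP[/eqP->|js].
  by apply: F'P => // h hF; apply: yx; rewrite mem_cat hF.
by apply: FP => // h hF; apply: yx; rewrite mem_cat hF orbT.
Qed.

Lemma locally_constant_borel (T : Type) (f : X -> T) (A : set T) :
  locally_constant f ->
  borel_set [set x : free_part dihedral | A (f (val x))].
Proof.
move=> lf; apply: sub_gen_smallest.
exists (\bigcup_(q in [set q | forall y, free_part dihedral y ->
    cylinder q y -> A (f y)]) cylinder q).
  by apply: bigcup_open => q _; exact: open_cylinder.
apply/seteqP; split=> [x [q qA xq]|x xA]; first by apply: qA => //; exact: set_valP.
have [F FP] := lf _ (set_valP x).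
exists (restriction (val x) F); last exact/cylinder_restriction.
by move=> y fy /cylinder_restriction yx; rewrite (FP y fy yx).
Qed.

(** * A locally constant index separating nearby points of an orbit *)

Section SeparatingIndex.
Variable B : seq dihedral.
Hypothesis B1 : 1%g \notin B.

Definition separating (q : seq dihedral * seq dihedral) :=
  forall (x : X) g, g \in B -> cylinder q x -> ~ cylinder q (shift_act g x).

Definition separating_code (x : X) (n : nat) : bool :=
  `[< exists q, [/\ pickle q = n, separating q & cylinder q x] >].

(** Each [g] in [B] changes [x] at some [w g]; fixing [x] at all [w g] and [g^-1 * w g] makes this
    change visible throughout the cylinder. *)
Lemma separating_code_exists x : free_part dihedral x ->
  exists n, separating_code x n.
Proof.
move=> fx; have /choice[w wP] : forall g, exists h : dihedral,
    g \in B -> shift_act g x h <> x h.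
  move=> g; have [gB|] := boolP (g \in B); last by exists 1%g.
  apply/not_existsP => allh; apply: (fx g).
    by move=> g1; move: B1; rewrite -g1 gB.
  apply/funext => h; apply: contrapT => hP; exact: (allh h).
pose F := [seq w g | g <- B] ++ [seq (g^-1 * w g)%g | g <- B].
exists (pickle (restriction x F)); apply/asboolP; exists (restriction x F).
split=> //; last exact/cylinder_restriction.
move=> y g gB /cylinder_restriction yx /cylinder_restriction gyx.
apply: (wP g gB); rewrite -gyx; last by rewrite mem_cat map_f.
rewrite /shift_act yx// mem_cat; apply/orP; right.
exact: (map_f (fun g => g^-1 * w g)%g gB).
Qed.

Definition separating_index (x : X) : nat :=
  if pselect (exists n, separating_code x n) is left e then ex_minn e else 0.

Lemma separating_indexP x : free_part dihedral x ->
  separating_code x (separating_index x) /\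
  forall n, separating_code x n -> (separating_index x <= n)%N.
Proof.
move=> /separating_code_exists ex; rewrite /separating_index.
by case: pselect => // e; case: ex_minnP.
Qed.

Lemma separating_index_neq x g : free_part dihedral x -> g \in B ->
  separating_index (shift_act g x) <> separating_index x.
Proof.
move=> fx gB eqi; have [/asboolP[q [qi sq xq]] _] := separating_indexP fx.
have [/asboolP[q' [q'i _ xq']] _] := separating_indexP (free_part_shift (g := g) fx).
move: q'i; rewrite eqi -qi => /(pcan_inj pickleK) qq; rewrite qq in xq'.
exact: (sq x g gB xq xq').
Qed.

(** The index is a least code, so it suffices to agree on the domains of the finitely many
    conditions with code up to [N]. *)
Lemma separating_index_locally_constant : locally_constant separating_index.
Proof.
move=> x fx; have [xi xmin] := separating_indexP fx.
set N := separating_index x in xi xmin *.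
pose Fn n : seq dihedral :=
  if @unpickle (seq dihedral * seq dihedral)%type n is Some q then q.1 else [::].
exists (flatten [seq Fn n | n <- iota 0 N.+1]) => y fy yx.
have [yi ymin] := separating_indexP fy.
have eqc n : (n <= N)%N -> separating_code y n = separating_code x n.
  move=> nN; have yxn (q : seq dihedral * seq dihedral) :
      pickle q = n -> {in q.1, y =1 x}.
    move=> qn h hq; apply: yx; apply/flatten_mapP; exists n.
      by rewrite mem_iota add0n ltnS.
    by rewrite /Fn -qn pickleK.
  apply/asboolP/asboolP => -[q [qn sq zq]]; exists q; split=> // h hq.
    by rewrite -(yxn q)// zq.
  by rewrite (yxn q)// zq.
have leN : (separating_index y <= N)%N by apply: ymin; rewrite eqc.
by apply/eqP; rewrite eqn_leq leN xmin// -eqc.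
Qed.

End SeparatingIndex.

(** * Greedy choice of a maximal discrete set *)

Section Markers.
Variables (B : seq dihedral) (idx : X -> nat).
Hypothesis B_inv : {in B, forall g, (g^-1)%g \in B}.
Hypothesis idx_neq : forall x g, free_part dihedral x -> g \in B ->
  idx (shift_act g x) <> idx x.
Hypothesis idx_lc : locally_constant idx.

(** Greedy selection in order of index: a point is chosen unless a neighbour of smaller index was.
    The argument [n] bounds the recursion depth, and any [n] above the index gives the same
    answer. *)
Fixpoint marker_rec n (x : X) : bool :=
  if n is m.+1 then
    all (fun g => (idx (shift_act g x) < idx x)%N ==>
                  ~~ marker_rec m (shift_act g x)) B
  else true.

Definition marker x := marker_rec (idx x).+1 x.

Lemma marker_rec_stable n m x : (idx x < n)%N -> (idx x < m)%N ->
  marker_rec n x = marker_rec m x.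
Proof.
elim: n m x => [//|n IHn] [//|m] x ltn ltm /=; apply: eq_in_all => g _.
case: ltnP => // ltg; congr (~~ _); apply: IHn; exact: leq_trans ltg _.
Qed.

Lemma markerE x : marker x =
  all (fun g => (idx (shift_act g x) < idx x)%N ==> ~~ marker (shift_act g x)) B.
Proof.
rewrite {1}/marker /=; apply: eq_in_all => g _; case: ltnP => // ltg.
by congr (~~ _); exact: marker_rec_stable.
Qed.

Lemma marker_discrete x g : free_part dihedral x -> g \in B ->
  marker x -> ~~ marker (shift_act g x).
Proof.
move=> fx gB mx; apply/negP => mgx.
have /eqP := idx_neq fx gB; rewrite neq_ltn => /orP[lt|lt].
  by move: mx; rewrite markerE => /allP/(_ g gB); rewrite lt mgx.
move: mgx; rewrite markerE => /allP/(_ _ (B_inv gB)).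
by rewrite -shift_actM mulVg shift_act1 lt mx.
Qed.

Lemma marker_maximal x : marker x \/ exists2 g, g \in B & marker (shift_act g x).
Proof.
have [mx|nmx] := boolP (marker x); [by left|right].
move: nmx; rewrite markerE => /allPn[g gB].
by rewrite negb_imply negbK => /andP[_ mg]; exists g.
Qed.

Lemma marker_locally_constant : locally_constant marker.
Proof.
move=> x; have [n] := ubnP (idx x); elim: n x => // n IHn x ltx fx.
(* The comparison is made at [x] and not at [y], so the induction hypothesis is called only on
   neighbours of smaller index. *)
pose f (g : dihedral) (y : X) := (idx (shift_act g y),
  (idx (shift_act g x) < idx x)%N && marker (shift_act g y)).
have [|F FP] := @locally_constant_at_all _ _ f (1%g :: B) x.
  move=> g _; have [F1 F1P] := idx_lc (free_part_shift (g := g) fx).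
  have lc1 : locally_constant_at (idx \o shift_act g) x.
    by apply: locally_constant_at_shift; exists F1.
  have [F2 F2P] : locally_constant_at
      (fun y => (idx (shift_act g x) < idx x)%N && marker (shift_act g y)) x.
    case: ltnP => /= [ltg|_]; last by exists [::].
    apply: (@locally_constant_at_shift _ marker); apply: IHn.
      by apply: leq_trans ltg _; rewrite -ltnS.
    exact: free_part_shift.
  have [F1' F1'P] := lc1.
  exists (F1' ++ F2) => y fy yx; rewrite /f; congr (_, _).
    by apply: F1'P => // h hF; apply: yx; rewrite mem_cat hF.
  by apply: F2P => // h hF; apply: yx; rewrite mem_cat hF orbT.
exists F => y fy yx; have fyx := FP y fy yx.
have eqi : idx y = idx x.
  by have [+ _] := fyx _ (mem_head _ _); rewrite !shift_act1.
rewrite !markerE; apply: eq_in_all => g gB.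
have /fyx[-> +] : g \in 1%g :: B by rewrite inE gB orbT.
by rewrite eqi; case: ltnP => // _ /= ->.
Qed.

End Markers.

Definition dball (r : nat) : seq dihedral :=
  [seq dalt b n | b <- [:: true; false], n <- iota 1 r].

Lemma mem_dball r g : (g \in dball r) = (0 < size (dword g) <= r)%N.
Proof.
apply/allpairsP/idP => [[[b n] [_ + ->]] /=|gr].
  by rewrite mem_iota size_alternating add1n ltnS.
have [b gE] := dihedralP g.
exists (b, size (dword g)); split=> //=; first by case: (b).
by rewrite mem_iota; lia.
Qed.

(** * Blocks and translations along an orbit *)

Definition flip (x : X) : X := shift_act da x.
Definition translation (x : X) : X := shift_act (db * da)%g x.
Local Notation A := flip.
Local Notation T := translation.
Local Notation free := (free_part dihedral).

Lemma flipK : involutive A.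
Proof.
by move=> x; rewrite /A -shift_actM (proj1 dihedral_relations) shift_act1.
Qed.

(** [flip] conjugates [translation] to its inverse; thus iterating [T] from [A x] explores the orbit
    backwards. *)
Lemma translation_flip x : T (A (T x)) = A x.
Proof.
by rewrite /T /A -!shift_actM; congr shift_act.
Qed.

Lemma iter_translation_flip i p x : (i <= p)%N ->
  iter i T (A (iter p T x)) = A (iter (p - i) T x).
Proof.
elim: i p => [|i IHi] [|p] // ip.
by rewrite iterSr /= translation_flip IHi.
Qed.

Lemma iter_translation i x : iter i T x = shift_act (dalt true i.*2) x.
Proof.
elim: i => [|i IHi]; first by rewrite dalt0 shift_act1.
by rewrite iterS IHi /T -shift_actM doubleS !daltS mulgA.
Qed.

Lemma flip_iter_translation i x :
  A (iter i T x) = shift_act (dalt false i.*2.+1) x.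
Proof. by rewrite iter_translation /A -shift_actM daltS. Qed.

Lemma flip_iter_translation_flip i x :
  A (iter i T (A x)) = shift_act (dalt false i.*2) x.
Proof.
elim: i => [|i IHi]; first by rewrite dalt0 shift_act1 /= flipK.
rewrite doubleS !daltS mulgA shift_actM -IHi iterS; move: (iter i T (A x)) => z.
by rewrite /A /T -!shift_actM mulgA.
Qed.

Lemma iter_translation_flipS i x :
  iter i.+1 T (A x) = shift_act (dalt true i.*2.+1) x.
Proof.
rewrite daltS shift_actM -flip_iter_translation_flip iterS /T /A.
by rewrite -!shift_actM.
Qed.

Lemma free_flip x : free x -> free (A x).
Proof. exact: free_part_shift. Qed.

Lemma free_iter i x : free x -> free (iter i T x).
Proof. by rewrite iter_translation; exact: free_part_shift. Qed.

(** * The upper bound *)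

Section Colouring.
Variables (k N : nat) (fill : nat -> bool -> bool -> nat -> nat).
Hypothesis k_gt0 : (0 < k)%N.
Hypothesis fillP : forall L, (N <= L)%N -> forall o1 o2,
  [/\ forall i, (i <= L)%N -> (fill L o1 o2 i <= k)%N,
      forall i j, (i < j)%N -> (j <= L)%N -> (j < i + k)%N ->
        fill L o1 o2 i <> fill L o1 o2 j,
      forall i, (i < k)%N -> fill L o1 o2 i = marker_colour k o1 i &
      forall i, (i < k)%N -> fill L o1 o2 (L - i) = marker_colour k o2 i].

(* Markers of distinct blocks are at least [half_width] blocks apart, and every
   block is within [half_width] blocks of a marker. *)
Definition half_width := (N + k).+1.
Definition marker_radius := half_width.*2.
(** Consecutive marked blocks are at most [half_width.*2.+1] blocks apart, and words of length up to
    [L.*2.+1] join blocks at distance [L]; so the two ends of a gap get different indices. *)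
Definition index_radius := (half_width.*2.+1).*2.+1.

Definition mindex := separating_index (dball index_radius).
Definition mset := marker (dball marker_radius) mindex.

Lemma dball1 r : 1%g \notin dball r.
Proof. by rewrite mem_dball. Qed.

Lemma mindex_neq x g : free x -> (0 < size (dword g) <= index_radius)%N ->
  mindex (shift_act g x) <> mindex x.
Proof.
by move=> fx gr; apply: separating_index_neq; rewrite ?dball1 ?mem_dball.
Qed.

Lemma mindex_lc : locally_constant mindex.
Proof. exact/separating_index_locally_constant/dball1. Qed.

Lemma mset_lc : locally_constant mset.
Proof. by apply: marker_locally_constant; exact: mindex_lc. Qed.

Lemma mset_discrete x g : free x -> (0 < size (dword g) <= marker_radius)%N ->
  mset x -> ~~ mset (shift_act g x).
Proof.
move=> fx gr; apply: marker_discrete => //; last by rewrite mem_dball.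
- by move=> h; rewrite !mem_dball size_rev.
- move=> y h fy; rewrite mem_dball => hr; apply: mindex_neq => //.
  by move: hr; rewrite /marker_radius /index_radius; lia.
Qed.

Definition marked x := mset x || mset (A x).

Lemma marked_flip x : marked (A x) = marked x.
Proof. by rewrite /marked flipK orbC. Qed.

Lemma mset_flip x : free x -> marked x -> mset (A x) = ~~ mset x.
Proof.
rewrite /marked => fx; have [mx _|_ /= ->//] := boolP (mset x).
apply/negbTE; apply: mset_discrete mx => //.
Qed.

(** Points of blocks at distance [L] are [2L - 1], [2L] or [2L + 1] steps apart, according to their
    places in the blocks. *)
Lemma block_element x L : (0 < L)%N -> forall b1 b2 : bool,
  exists2 g, (0 < size (dword g) <= L.*2.+1)%N &
  (if b2 then iter L T x else A (iter L T x)) =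
  shift_act g (if b1 then x else A x).
Proof.
case: L => // L _ b1 b2.
have [y ->] : exists y, x = A y by exists (A x); rewrite flipK.
case: b1; case: b2; rewrite ?flipK.
- exists (dalt true L.+1.*2); first by rewrite size_alternating; lia.
  by rewrite -iter_translation.
- exists (dalt false L.+1.*2.+1); first by rewrite size_alternating; lia.
  by rewrite -flip_iter_translation.
- exists (dalt true L.*2.+1); first by rewrite size_alternating; lia.
  by rewrite -iter_translation_flipS.
- exists (dalt false L.+1.*2); first by rewrite size_alternating; lia.
  by rewrite -flip_iter_translation_flip.
Qed.

Lemma marked_sep x L : free x -> (0 < L)%N -> marked x -> marked (iter L T x) ->
  (half_width <= L)%N.
Proof.
move=> fx L0 mx mL; rewrite leqNgt; apply/negP => Lh.
have [b1 m1] : exists b, mset (if b then x else A x).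
  by case/orP: mx; [exists true|exists false].
have [b2 m2] : exists b, mset (if b then iter L T x else A (iter L T x)).
  by case/orP: mL; [exists true|exists false].
have [g gL gE] := block_element x L0 b1 b2.
have fb : free (if b1 then x else A x) by case: (b1) => //; exact: free_flip.
have := @mset_discrete _ g fb _ m1; rewrite -gE m2.
by move=> /(_ _)/negP; case=> //; rewrite /marker_radius; lia.
Qed.

Lemma marked_near x : exists2 i, (i <= half_width)%N &
  marked (iter i T x) \/ marked (iter i T (A x)).
Proof.
have [mx|[g]] := marker_maximal (dball marker_radius) mindex x.
  by exists 0%N => //; left; rewrite /marked [mset _]mx.
rewrite mem_dball -/mset => gr; have [b ->] := dihedralP g.
move: (size (dword g)) gr => n; rewrite /marker_radius => gr.
have := odd_double_half n; move: n./2 => i.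
case: (odd n) => /=; rewrite ?add1n ?add0n => nE; rewrite -nE => mg; last first.
  exists i; first lia.
  case: b mg => mg; [left|right].
    by rewrite /marked iter_translation mg.
  by rewrite /marked flip_iter_translation_flip mg orbT.
case: b mg => mg.
  exists i.+1; first lia.
  by right; rewrite /marked iter_translation_flipS mg.
exists i; first lia.
by left; rewrite /marked flip_iter_translation mg orbT.
Qed.

Lemma marked_ahead x : exists2 i, (i <= half_width.*2)%N & marked (iter i T x).
Proof.
(* A marked block within [half_width] of the block [half_width] ahead is still ahead of [x], on
   whichever side it lies. *)
have [i ih [mi|mi]] := marked_near (iter half_width T x).
  by exists (i + half_width)%N; [lia|rewrite iterD].
exists (half_width - i)%N; first lia.
by rewrite -marked_flip -iter_translation_flip.
Qed.

Definition next_marked x :=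
  find (fun i => marked (iter i T x)) (iota 0 half_width.*2.+1).

Lemma next_markedP x : [/\ (next_marked x <= half_width.*2)%N,
  marked (iter (next_marked x) T x) &
  forall i, (i < next_marked x)%N -> ~~ marked (iter i T x)].
Proof.
have hx : has (fun i => marked (iter i T x)) (iota 0 half_width.*2.+1).
  have [i ih mi] := marked_ahead x; apply/hasP; exists i => //.
  by rewrite mem_iota.
have lth : (next_marked x < half_width.*2.+1)%N.
  by move: hx; rewrite has_find size_iota.
split=> //; first by have := nth_find 0%N hx; rewrite nth_iota.
move=> i ltx; have /negbT := before_find 0%N ltx.
by rewrite nth_iota// (ltn_trans ltx).
Qed.

Lemma next_marked_eq x L : marked (iter L T x) ->
  (forall i, (i < L)%N -> ~~ marked (iter i T x)) -> next_marked x = L.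
Proof.
move=> mL nm; have [_ mx nmx] := next_markedP x.
case: (ltngtP (next_marked x) L) => // [/nm|/nmx]; first by rewrite mx.
by rewrite mL.
Qed.

Definition marker_index x := if mset x then mindex x else mindex (A x).

Lemma marker_index_neq x L : free x -> (0 < L <= half_width.*2.+1)%N ->
  marked x -> marker_index (A x) <> marker_index (iter L T x).
Proof.
move=> fx /andP[L0 Lh] mx.
have -> : marker_index (A x) = mindex (if ~~ mset (A x) then x else A x).
  by rewrite /marker_index flipK; case: (mset (A x)).
have -> : marker_index (iter L T x) =
    mindex (if mset (iter L T x) then iter L T x else A (iter L T x)).
  by rewrite /marker_index; case: ifP.
have [g gL ->] := block_element x L0 (~~ mset (A x)) (mset (iter L T x)).
apply/nesym/mindex_neq; first by case: ifP => // _; exact: free_flip.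
by rewrite /index_radius; lia.
Qed.

(* A gap between two markers is filled starting from the end of smaller index;
   this choice makes the colouring invariant under [flip], which reverses
   the orbit. *)
Definition colour x :=
  if marked x then 0 else
  let l := next_marked (A x) in let r := next_marked x in
  let e1 := iter l T (A x) in let e2 := iter r T x in
  if (marker_index e1 < marker_index e2)%N
  then fill (l + r) (mset e1) (mset e2) l
  else fill (l + r) (mset e2) (mset e1) r.

(** * Gaps between consecutive marked blocks *)

Definition gap y L := [/\ free y, (half_width <= L <= half_width.*2.+1)%N,
  marked y, marked (iter L T y) &
  forall i, (0 < i < L)%N -> ~~ marked (iter i T y)].

Definition gap_colour y L p :=
  if (marker_index (A y) < marker_index (iter L T y))%N
  then fill L (mset (A y)) (mset (iter L T y)) p
  else fill L (mset (iter L T y)) (mset (A y)) (L - p).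

(** From an interior block the two searches find the ends of the gap, at distances [p] and [L - p].
    At the ends both fillings give [0], the colour of every marked block. *)
Lemma colour_gap y L p : gap y L -> (p <= L)%N ->
  colour (iter p T y) = gap_colour y L p.
Proof.
move=> [fy hL my mL nm] pL.
have NL : (N <= L)%N by move: hL; rewrite /half_width; lia.
have fill0 o1 o2 : fill L o1 o2 0 = 0%N.
  by have [_ _ + _] := fillP NL o1 o2 => ->//; rewrite marker_colour0.
have fillL o1 o2 : fill L o1 o2 L = 0%N.
  have [_ _ _ /(_ 0%N k_gt0)] := fillP NL o1 o2.
  by rewrite subn0 marker_colour0.
rewrite /colour /gap_colour; case: ifP => [mp|/negbT nmp].
  have [->|p0] := eqVneq p 0%N; first by rewrite subn0 fill0 fillL; case: ifP.
  have [->|pL'] := eqVneq p L; first by rewrite subnn fill0 fillL; case: ifP.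
  by have := nm p; rewrite mp => /(_ _)/negP; case=> //; lia.
have p0 : (0 < p)%N by rewrite lt0n; apply: contra nmp => /eqP->.
have pL' : (p < L)%N.
  by rewrite ltn_neqAle pL andbT; apply: contra nmp => /eqP->.
have rE : next_marked (iter p T y) = (L - p)%N.
  apply: next_marked_eq => [|i iL]; first by rewrite -iterD subnK.
  by rewrite -iterD; apply: nm; lia.
have lE : next_marked (A (iter p T y)) = p.
  apply: next_marked_eq => [|i ip].
    by rewrite iter_translation_flip// subnn marked_flip.
  by rewrite iter_translation_flip 1?ltnW// marked_flip; apply: nm; lia.
by rewrite rE lE iter_translation_flip// subnn -iterD subnK// addnC subnK.
Qed.

Lemma gap_next y : free y -> marked y -> gap y (next_marked (T y)).+1.
Proof.
move=> fy my; have [lh mL nm] := next_markedP (T y).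
have mL' : marked (iter (next_marked (T y)).+1 T y) by rewrite iterSr.
split=> //; first by rewrite ltnS lh andbT (marked_sep fy _ my mL').
by move=> [//|i] /= iL; rewrite -iterS iterSr; exact: nm.
Qed.

Lemma gap_around z : free z -> ~~ marked z -> exists y L p,
  [/\ gap y L, z = iter p T y, (0 < p < L)%N & next_marked z = (L - p)%N].
Proof.
move=> fz nmz; have [lh ml nml] := next_markedP (A z).
have [rh mr nmr] := next_markedP z.
set l := next_marked (A z) in lh ml nml.
set r := next_marked z in rh mr nmr *.
have l0 : (0 < l)%N.
  by rewrite lt0n; apply: contra nmz => /eqP l0; rewrite l0 /= marked_flip in ml.
have r0 : (0 < r)%N.
  by rewrite lt0n; apply: contra nmz => /eqP r0; rewrite r0 /= in mr.
pose y := A (iter l T (A z)).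
have zE : z = iter l T y by rewrite /y iter_translation_flip// subnn /= flipK.
have yE i : (i <= l)%N -> iter i T y = A (iter (l - i) T (A z)).
  by move=> il; rewrite /y iter_translation_flip.
have fy : free y by apply/free_flip/free_iter/free_flip.
have my : marked y by rewrite marked_flip.
have LE : (next_marked (T y)).+1 = (l + r)%N.
  have -> : next_marked (T y) = (l + r).-1; last by lia.
  apply: next_marked_eq => [|i ilr]; rewrite -iterSr.
    have -> : (l + r).-1.+1 = (r + l)%N by lia.
    by rewrite iterD -zE.
  have [il|li] := leqP i.+1 l.
    by rewrite yE// marked_flip; apply: nml; lia.
  have -> : i.+1 = ((i.+1 - l) + l)%N by lia.
  by rewrite iterD -zE; apply: nmr; lia.
exists y, (l + r)%N, l; split=> //; last by lia.
  by rewrite -LE; exact: gap_next.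
by lia.
Qed.

Lemma gap_colour_neq y L p q : gap y L -> (p < q <= L)%N -> (q < p + k)%N ->
  gap_colour y L p <> gap_colour y L q.
Proof.
move=> [_ hL _ _ _] pq qk.
have NL : (N <= L)%N by move: hL; rewrite /half_width; lia.
rewrite /gap_colour; case: ifP => _.
  by have [_ + _ _] := fillP NL (mset (A y)) (mset (iter L T y)); apply; lia.
have [_ + _ _] := fillP NL (mset (iter L T y)) (mset (A y)) => fneq.
by apply/nesym/fneq; lia.
Qed.

(** Either filling is prescribed within [k] blocks of both ends, so the comparison of indices does
    not matter there. *)
Lemma colour_near_marked y i : free y -> marked y -> (i < k)%N ->
  colour (iter i T y) = marker_colour k (mset (A y)) i.
Proof.
move=> fy my ik; have gy := gap_next fy my; have [_ hL _ _ _] := gy.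
set L := (next_marked _).+1 in gy hL.
have NL : (N <= L)%N by move: hL; rewrite /half_width; lia.
have iL : (i <= L)%N by move: hL; rewrite /half_width; lia.
rewrite (colour_gap gy iL) /gap_colour; case: ifP => _.
  by have [_ _ + _] := fillP NL (mset (A y)) (mset (iter L T y)); exact.
by have [_ _ _] := fillP NL (mset (iter L T y)) (mset (A y)); exact.
Qed.

(** Passing to [A x] exchanges the two ends of the gap. Their indices differ, so the same end is
    smaller and the same letter of the same filling is read. *)
Lemma colour_flip x : free x -> colour (A x) = colour x.
Proof.
move=> fx; rewrite /colour marked_flip flipK; case: ifP => // /negbT nmx.
have [y [L [p [[fy hL my mL nm] xE pL rE]]]] := gap_around fx nmx.
have lE : next_marked (A x) = p.
  rewrite xE; apply: next_marked_eq => [|i ip].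
    by rewrite iter_translation_flip// subnn marked_flip.
  by rewrite iter_translation_flip 1?ltnW// marked_flip; apply: nm; lia.
have e1 : iter p T (A x) = A y by rewrite xE iter_translation_flip// subnn.
have e2 : iter (L - p) T x = iter L T y by rewrite xE -iterD subnK//; lia.
rewrite lE rE e1 e2 addnC.
have hL' : (0 < L <= half_width.*2.+1)%N by move: hL; rewrite /half_width; lia.
have /eqP := marker_index_neq fy hL' my; rewrite neq_ltn.
by case/orP=> lt; rewrite lt ltnNge ltnW.
Qed.

Lemma colour_le x : free x -> (colour x <= k)%N.
Proof.
move=> fx; have [mx|nmx] := boolP (marked x); first by rewrite /colour mx.
have [y [L [p [gy xE pL _]]]] := gap_around fx nmx.
have pL' : (p <= L)%N by lia.
rewrite xE (colour_gap gy pL') /gap_colour; have [_ hL _ _ _] := gy.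
have NL : (N <= L)%N by move: hL; rewrite /half_width; lia.
case: ifP => _.
  by have [+ _ _ _] := fillP NL (mset (A y)) (mset (iter L T y)); exact.
have [+ _ _ _] := fillP NL (mset (iter L T y)) (mset (A y)); apply.
exact: leq_subr.
Qed.

Lemma colour_translation_neq x j : free x -> (0 < j < k)%N ->
  colour (iter j T x) <> colour x.
Proof.
move=> fx jk; have [_ mr nmr] := next_markedP x.
(* Without a marked block before the [j]-th, both points lie in one gap; otherwise they lie on
   opposite sides of the marked block [m], or [x] itself is in it. *)
have [rj|jr] := ltnP (next_marked x) j; last first.
  have nmx : ~~ marked x by apply: (nmr 0%N); lia.
  have [y [L [p [gy xE pL rE]]]] := gap_around fx nmx.
  have pL' : (p <= L)%N by lia.
  have jpL : (j + p <= L)%N by lia.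
  rewrite xE -iterD (colour_gap gy pL') (colour_gap gy jpL).
  by apply/nesym; apply: (gap_colour_neq gy); lia.
set r := next_marked x in mr rj nmr; pose m := iter r T x.
have fm : free m by exact: free_iter.
have -> : iter j T x = iter (j - r) T m by rewrite -iterD subnK// ltnW.
(* Seen from [A m], the point [A x] lies ahead. A marker points to only one side, so the two sides
   carry opposite orientations. *)
rewrite -(colour_flip fx).
have -> : A x = iter r T (A m) by rewrite iter_translation_flip// subnn.
rewrite !colour_near_marked ?marked_flip//; try lia; last exact: free_flip.
rewrite flipK mset_flip//; have := @marker_colour_neq k k_gt0 (~~ mset m) (j - r) r.
by rewrite negbK; apply; lia.
Qed.

Lemma colour_locally_constant : locally_constant colour.
Proof.
move=> x fx.
(* The colour depends only on [mset] and [mindex] at these finitely many points: [half_width.*2]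
   blocks in each direction, with both points of every block. *)
pose pt (u : bool * nat * bool) (y : X) : X :=
  let z := iter u.1.2 T (if u.2 then A y else y) in if u.1.1 then A z else z.
pose f u y := (mset (pt u y), mindex (pt u y)).
have lf : locally_constant (fun y => (mset y, mindex y)).
  move=> y fy; have [F1 F1P] := mset_lc fy; have [F2 F2P] := mindex_lc fy.
  exists (F1 ++ F2) => z fz zy; congr (_, _).
    by apply: F1P => // h hF; apply: zy; rewrite mem_cat hF.
  by apply: F2P => // h hF; apply: zy; rewrite mem_cat hF orbT.
pose s := [seq (bi, b) | bi <- [seq (b, i) | b <- [:: true; false],
  i <- iota 0 half_width.*2.+1], b <- [:: true; false]].
have [u _|F FP] := @locally_constant_at_all _ _ f s x.
  have [g gE] : exists g, forall y, pt u y = shift_act g y.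
    case: u => -[[] i] []; rewrite /pt /=.
    - by exists (dalt false i.*2) => y; exact: flip_iter_translation_flip.
    - by exists (dalt false i.*2.+1) => y; exact: flip_iter_translation.
    - by exists (dalt true i.*2 * da)%g => y; rewrite iter_translation shift_actM.
    - by exists (dalt true i.*2) => y; exact: iter_translation.
  have [F FP] := locally_constant_shift g lf fx.
  by exists F => y fy yx; have := FP y fy yx; rewrite /f !gE.
exists F => y fy yx.
have H b i b' : (i <= half_width.*2)%N -> f (b, i, b') y = f (b, i, b') x.
  move=> ih; apply: (FP y fy yx); apply/allpairsP; exists ((b, i), b').
  split=> //; last by case: (b').
  apply/allpairsP; exists (b, i); split=> //; first by case: (b).
  by rewrite mem_iota.
pose q b (z : X) := if b then A z else z.
have Hm b i : (i <= half_width.*2)%N ->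
    mset (iter i T (q b y)) = mset (iter i T (q b x)).
  by move=> /(H false i b)[].
have Hk b i : (i <= half_width.*2)%N ->
    marked (iter i T (q b y)) = marked (iter i T (q b x)).
  by move=> ih; rewrite /marked (Hm _ _ ih); have [-> _] := H true i b ih.
have Hi b i : (i <= half_width.*2)%N ->
    marker_index (iter i T (q b y)) = marker_index (iter i T (q b x)).
  move=> ih; rewrite /marker_index (Hm _ _ ih); have [_] := H true i b ih.
  by rewrite /pt /= => ->; have [_] := H false i b ih; rewrite /pt /= => ->.
have Hr b : next_marked (q b y) = next_marked (q b x).
  apply: eq_in_find => i; rewrite mem_iota add0n ltnS => /andP[_].
  exact: Hk.
have [lh _ _] := next_markedP (A x); have [rh _ _] := next_markedP x.
rewrite /colour (Hk false 0%N)// (Hr true) (Hr false).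
by rewrite (Hm true)// (Hm false)// (Hi true)// (Hi false).
Qed.

End Colouring.

Lemma shift_graph_colorable k (hk : (3 <= k)%N) :
  borel_colorable (@shift_graph (Delta' hk)) (k + 1).
Proof.
have k_gt0 : (0 < k)%N by lia.
have [N NP] := gap_filling k_gt0.
have /choice[fill fillP] : forall u : nat * bool * bool, exists f : nat -> nat,
    (N <= u.1.1)%N ->
    [/\ forall i, (i <= u.1.1)%N -> (f i <= k)%N,
        forall i j, (i < j)%N -> (j <= u.1.1)%N -> (j < i + k)%N -> f i <> f j,
        forall i, (i < k)%N -> f i = marker_colour k u.1.2 i &
        forall i, (i < k)%N -> f (u.1.1 - i) = marker_colour k u.2 i].
  move=> [[L o1] o2] /=; have [NL|ltL] := leqP N L; last by exists id.
  by have [f fP] := NP L NL o1 o2; exists f.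
pose fill' L o1 o2 := fill (L, o1, o2).
pose col := colour k N fill'.
have fillP' L (NL : (N <= L)%N) o1 o2 := fillP (L, o1, o2) NL.
have col_lc : locally_constant col := colour_locally_constant N fill' k_gt0.
have col_le x : free x -> (col x < k + 1)%N.
  by move=> fx; rewrite addn1 ltnS; exact: (colour_le k_gt0 fillP').
pose c (x : free_part dihedral) : 'I_(k + 1) :=
  Ordinal (col_le _ (set_valP x)).
exists c => [S|x y].
  have -> : c @^-1` S = [set x : free_part dihedral |
      [set n | exists2 i, S i & nat_of_ord i = n] (col (val x))].
    apply/seteqP; split=> [x xS|x [i iS ix]] /=; first by exists (c x).
    by have -> : c x = i by exact: val_inj.
  exact: locally_constant_borel.
move=> [_ [s /andP[s2 sk] sxy]] /(congr1 val) /=; rewrite -sxy => /esym.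
have fx : free (val x) := set_valP x.
have flipc z : free z -> col (A z) = col z by exact: colour_flip.
have neq z j : free z -> (0 < j < k)%N -> col (iter j T z) <> col z.
  by move=> fz; exact: (colour_translation_neq k_gt0 fillP').
have fAx := free_flip fx.
(* By parity and first letter, a generator moves the block of [x] by between [1] and [k - 1] blocks;
   invariance under [flip] reduces each case to iterates of [T]. *)
have [b sE] := dihedralP s; move: s2 sk; rewrite sE size_alternating.
rewrite -(odd_double_half (size (dword s))); set i := _./2.
case: odd => /=; rewrite ?add1n ?add0n; case: b {sE} => s2 sk.
- by rewrite -iter_translation_flipS -(flipc (val x))//; apply: neq => //; lia.
- rewrite -flip_iter_translation flipc; last exact: free_iter.
  by apply: neq => //; lia.
- by rewrite -iter_translation; apply: neq => //; lia.
- rewrite -flip_iter_translation_flip flipc; last exact: free_iter.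
  by rewrite -(flipc (val x))//; apply: neq => //; lia.
Qed.

Theorem theorem7 (k : nat) (hk : (3 <= k)%N) :
  borel_chromatic_number_is (@shift_graph (Delta' hk)) (k + 1)%N.
Proof.
split=> [|m [c borel_c proper_c]]; first exact: shift_graph_colorable.
rewrite addn1 ltnNge; apply/negP => mk; apply: (@shift_graph_not_colorable k hk).
exists (widen_ord mk \o c) => [S|x y /proper_c cxy /(congr1 val) /= cE].
  exact: (borel_c (widen_ord mk @^-1` S)).
exact/cxy/val_inj.
Qed.
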